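(* Consider the system $x(k+1)=A_{\sigma(k)}x(k)+B_{a(k)}u(k)$, $y(k)=x(k)$, described in the context, and a routing policy (discrete control) fixed a priori by $a(k)=a_k\in A$ for all $k\ge 0$. Then the optimal solution of the problem of designing, for $k\in\{0,\dots,N-1\}$, a state-feedback control $u^*(k)=K^*(x(k))x(k)$ minimizing $$J=E\Big\{\sum_{k=0}^{N-1}\big(x'(k)Mx(k)+u'(k)Ru(k)\big)+x'(N)Qx(N)\ \Big|\ \aleph_0\Big\}$$ is given by a sequence of gain matrices $K^*(k)\in\mathbb{R}^{mr\times n}$, $k=0,\dots,N-1$, i.e. by $u^*(k)=K^*(k)x(k)$.
   Context: System: $x(k)\in\mathbb{R}^n$ is the state, which is measured ($y(k)=x(k)$), $u(k)\in\mathbb{R}^{mr}$ is the continuous control, $\sigma(k)\in\Sigma=\{1,\dots,q\}$ is a random mode not measured by the controller, and $a(k)\in A=\{1,\dots,p\}$ is a discrete control. $A_1,\dots,A_q$ and $B_1,\dots,B_p$ are given real matrices of sizes $n\times n$ and $n\times mr$. The process $\sigma(k)$, $k\ge 0$, is a sequence of i.i.d. random variables with $\mathbb{P}[\sigma(k)=i]=\pi_i$ for all $i\in\Sigma$, $k\ge 0$. $N$ is a finite horizon. $M$, $R$, $Q$ are constant real weight matrices of sizes $n\times n$, $mr\times mr$, $n\times n$, with $Q$ symmetric. A prime denotes transpose, $E$ is expectation, and $\aleph_k$ is the sigma-algebra generated by $x(0),\dots,x(k)$.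
   Formalization: The formal statement adds that x(0) is independent of the mode process σ(k), and that the costs J of all measurable state feedbacks are almost surely bounded below by a common finite random variable (so that an optimal solution can exist); without either the claim fails. *)

(* Defs.v *)
(* MathComp / MathComp-Analysis. *)
From HB Require Import structures.
From mathcomp Require Import all_boot all_order all_algebra.
From mathcomp Require Import all_classical all_reals all_analysis.

Set Implicit Arguments.
Unset Strict Implicit.
Unset Printing Implicit Defensive.

Import Order.TTheory GRing.Theory Num.Theory.
Import numFieldNormedType.Exports.

Local Open Scope classical_set_scope.
Local Open Scope ring_scope.

Definition borel_mx (R : realType) (m n : nat) : set (set 'M[R]_(m, n)) :=
  <<s [set U | open U] >>.

Section probability_notions.
Context {d : measure_display} {Omega : measurableType d} {R : realType}.
Variable P : probability Omega R.

Definition mutually_independent (I : eqType) (F : I -> set (set Omega)) : Prop :=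
  forall (s : seq I) (E : I -> set Omega), uniq s ->
    (forall i, i \in s -> F i (E i)) ->
    P (\big[setI/setT]_(i <- s) E i) = (\prod_(i <- s) P (E i))%E.

Definition independent2 (F G : set (set Omega)) : Prop :=
  forall E D, F E -> G D -> P (E `&` D) = (P E * P D)%E.

(* Y is a version of E[X | G] for a real random variable X that is only
   sigma-integrable with respect to the sigma-algebra G: X is integrable on each
   member of an exhausting sequence of events of G.  For integrable X this is
   the usual notion, and Y is still unique up to a P-null set.  No moment
   assumption on the initial state is then needed for the cost below. *)
Definition is_cond_exp (G : set (set Omega)) (X Y : Omega -> R) : Prop :=
  preimage_set_system setT Y measurable `<=` G /\
  exists D : nat -> set Omega,
    [/\ forall j, G (D j),
        nondecreasing_seq D,
        \bigcup_j D j = setT,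
        forall j, P.-integrable (D j) (EFin \o X) /\
                  P.-integrable (D j) (EFin \o Y) &
        forall j E, G E -> E `<=` D j ->
          (\int[P]_(w in E) (X w)%:E = \int[P]_(w in E) (Y w)%:E)%E].

Section modes.
Variable q : nat.

Definition mode_algebra (s : Omega -> 'I_q) : set (set Omega) :=
  preimage_set_system setT s setT.

Definition iid_modes (pi : 'I_q -> R) (sigma : nat -> Omega -> 'I_q) : Prop :=
  [/\ forall k, mode_algebra (sigma k) `<=` measurable,
      mutually_independent (fun k => mode_algebra (sigma k)) &
      forall k i, P (sigma k @^-1` [set i]) = (pi i)%:E].

End modes.
End probability_notions.

Section control_problem.
Context {R : realType} {n l p q : nat}.
Variables (A : 'I_q -> 'M[R]_n) (B : 'I_p -> 'M[R]_(n, l)) (a : nat -> 'I_p).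
Variables (M : 'M[R]_n) (W : 'M[R]_l) (Q : 'M[R]_n) (N : nat).

(* The gain K k x is the matrix K(x) used at time k when x(k) = x, so that the
   control is u(k) = K k (x(k)) *m x(k).  Only the times k < N matter. *)
Definition feedback := nat -> 'cV[R]_n -> 'M[R]_(l, n).

Definition admissible (K : feedback) : Prop :=
  forall k, (k < N)%N ->
    preimage_set_system setT (K k) (@borel_mx R l n) `<=` @borel_mx R n 1.

Definition linear_feedback (K : nat -> 'M[R]_(l, n)) : feedback :=
  fun k _ => K k.

Fixpoint state (K : feedback) (x0 : 'cV[R]_n) (s : nat -> 'I_q) (k : nat) :
    'cV[R]_n :=
  if k is j.+1 then
    let x := state K x0 s j in A (s j) *m x + B (a j) *m (K j x *m x)
  else x0.

Definition control (K : feedback) (x0 : 'cV[R]_n) (s : nat -> 'I_q) (k : nat) :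
    'cV[R]_l :=
  let x := state K x0 s k in K k x *m x.

Definition quad (m : nat) (S : 'M[R]_m) (x : 'cV[R]_m) : R :=
  (x^T *m S *m x) 0 0.

Definition path_cost (K : feedback) (x0 : 'cV[R]_n) (s : nat -> 'I_q) : R :=
  \sum_(k < N) (quad M (state K x0 s k) + quad W (control K x0 s k)) +
  quad Q (state K x0 s N).

Context {d : measure_display} {Omega : measurableType d}.
Variables (P : probability Omega R).
Variables (sigma : nat -> Omega -> 'I_q) (x0 : Omega -> 'cV[R]_n).

Definition aleph0 : set (set Omega) :=
  preimage_set_system setT x0 (@borel_mx R n 1).

Definition initial_state : Prop :=
  aleph0 `<=` measurable /\
  independent2 P aleph0 <<s \bigcup_k mode_algebra (sigma k) >>.

Definition is_cost (K : feedback) (J : Omega -> R) : Prop :=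
  is_cond_exp P aleph0 (fun w => path_cost K (x0 w) (sigma ^~ w)) J.

(* The weights are not assumed definite, so the infimum of the cost may be
   -oo; this says that it is not. *)
Definition cost_bounded_below : Prop :=
  exists Y : Omega -> R, forall K J, admissible K -> is_cost K J ->
    {ae P, forall w, Y w <= J w}.

Definition optimal (K : feedback) : Prop :=
  admissible K /\
  exists J, is_cost K J /\
    forall K' J', admissible K' -> is_cost K' J' ->
      {ae P, forall w, J w <= J' w}.

End control_problem.

(* Main.v *)
Require Import Defs.
From HB Require Import structures.
From mathcomp Require Import all_boot all_order all_algebra.
From mathcomp Require Import all_classical all_reals all_analysis.
From mathcomp Require Import measurable_realfun ring lra.

Set Implicit Arguments.
Unset Strict Implicit.
Unset Printing Implicit Defensive.

Import Order.TTheory GRing.Theory Num.Theory.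
Import numFieldNormedType.Exports.

Local Open Scope classical_set_scope.
Local Open Scope ring_scope.

(* Since x(0) is independent of the modes, E[cost | aleph_0] is a deterministic
   cost-to-go evaluated at x(0), and dynamic programming runs pointwise in the
   state.  By backward induction the value function is quadratic on the set G of
   states where it is finite, G is a linear subspace, and a linear gain is
   optimal there: the one-step problem minimizes u'Hu + 2u'Lx, which is bounded
   below iff H >= 0 and Lx is in the range of H, with minimizer u = -H^+ L x.
   If H is not positive semidefinite, or if im B is not contained in the next G,
   then G = {0}: the control K(x)x vanishes at x = 0, so the state 0 always has
   finite cost.
   Outside G the cost is already unbounded below along a countable family of
   linear gains.  Countability makes the exceptional null sets harmless, so the
   bound on the costs puts x(0) in G almost surely. *)

(** * Bilinear and quadratic forms given by matrices *)

Section bilinear.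
Context {R : realType}.
Implicit Types m n k l : nat.

Definition bilin m n (S : 'M[R]_(m, n)) (x : 'cV[R]_m) (y : 'cV[R]_n) : R :=
  (x^T *m S *m y) 0 0.

Lemma quadE m (S : 'M[R]_m) x : quad S x = bilin S x x.
Proof. by []. Qed.

Lemma bilinDl m n (S : 'M[R]_(m, n)) x1 x2 y :
  bilin S (x1 + x2) y = bilin S x1 y + bilin S x2 y.
Proof. by rewrite /bilin linearD /= !mulmxDl mxE. Qed.

Lemma bilinDr m n (S : 'M[R]_(m, n)) x y1 y2 :
  bilin S x (y1 + y2) = bilin S x y1 + bilin S x y2.
Proof. by rewrite /bilin mulmxDr mxE. Qed.

Lemma bilinZl m n (S : 'M[R]_(m, n)) c x y : bilin S (c *: x) y = c * bilin S x y.
Proof. by rewrite /bilin linearZ /= -!scalemxAl mxE. Qed.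

Lemma bilinZr m n (S : 'M[R]_(m, n)) c x y : bilin S x (c *: y) = c * bilin S x y.
Proof. by rewrite /bilin -scalemxAr mxE. Qed.

Lemma bilin0r m n (S : 'M[R]_(m, n)) x : bilin S x 0 = 0.
Proof. by rewrite /bilin mulmx0 mxE. Qed.

Lemma bilinD m n (S T : 'M[R]_(m, n)) x y :
  bilin (S + T) x y = bilin S x y + bilin T x y.
Proof. by rewrite /bilin mulmxDr mulmxDl mxE. Qed.

Lemma bilinZ m n c (S : 'M[R]_(m, n)) x y : bilin (c *: S) x y = c * bilin S x y.
Proof. by rewrite /bilin -scalemxAr -scalemxAl mxE. Qed.

Lemma bilin_sum m n (I : finType) (S : I -> 'M[R]_(m, n)) x y :
  bilin (\sum_i S i) x y = \sum_i bilin (S i) x y.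
Proof. by rewrite /bilin mulmx_sumr mulmx_suml summxE. Qed.

Lemma bilin_tr m n (S : 'M[R]_(m, n)) x y : bilin S^T y x = bilin S x y.
Proof.
have -> : bilin S x y = ((x^T *m S *m y)^T) 0 0 by rewrite mxE.
by rewrite !trmx_mul trmxK mulmxA.
Qed.

Lemma bilin_mulmx m n k l (S : 'M[R]_(m, n)) (A : 'M[R]_(m, k)) (B : 'M[R]_(n, l)) x y :
  bilin S (A *m x) (B *m y) = bilin (A^T *m S *m B) x y.
Proof. by rewrite /bilin trmx_mul !mulmxA. Qed.

Lemma quad0 m (S : 'M[R]_m) : quad S 0 = 0.
Proof. exact: bilin0r. Qed.

Lemma bilin_1_gt0 m (x : 'cV[R]_m) : x != 0 -> 0 < bilin 1%:M x x.
Proof.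
move=> x0; rewrite /bilin mulmx1 mxE.
under eq_bigr do rewrite mxE -expr2.
rewrite lt_neqAle sumr_ge0 ?andbT; last by move=> i _; rewrite sqr_ge0.
rewrite eq_sym; apply: contra x0 => /eqP s0; apply/eqP/colP => i.
have := @psumr_eq0P _ _ (fun=> true) _ (fun j _ => sqr_ge0 (x j 0)) s0 i isT.
by rewrite !mxE => /eqP; rewrite sqrf_eq0 => /eqP.
Qed.

(** The symmetric part gives the same quadratic form; symmetry is what lets the two cross terms of
    an expanded square be merged. *)
Definition symmx m (S : 'M[R]_m) : 'M[R]_m := 2^-1 *: (S + S^T).

Lemma symmx_sym m (S : 'M[R]_m) : (symmx S)^T = symmx S.
Proof. by rewrite /symmx linearZ linearD /= trmxK addrC. Qed.

Lemma quad_symmx m (S : 'M[R]_m) x : quad (symmx S) x = quad S x.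
Proof. rewrite !quadE bilinZ bilinD bilin_tr; lra. Qed.

End bilinear.

(** * Minimization and unboundedness of quadratic functions *)

(** If [alpha < 0], a large [t] gives [t * alpha + beta < -1], so the variable part is at most
    [- t]; otherwise the linear term alone tends to minus infinity. Taking [t] in [nat] keeps the
    gains scaled by it countable. *)
Lemma lt0_quadratic_unbounded (R : realType) (alpha beta c b : R) :
  alpha < 0 \/ (alpha = 0 /\ beta < 0) ->
  exists t : nat, c + t%:R ^+ 2 * alpha + t%:R * beta < b.
Proof.
have nb := normr_ge0 beta; have nc := normr_ge0 c; have nbb := normr_ge0 b.
case=> [a0|[-> b0]].
  pose s := Num.bound ((`|beta| + 1) / - alpha).
  pose s' := Num.bound (`|c| + `|b|).
  have hs : (`|beta| + 1) / - alpha < s%:R.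
    by apply: archi_boundP; apply: divr_ge0; lra.
  have hs' : `|c| + `|b| < s'%:R by apply: archi_boundP; rewrite addr_ge0.
  exists (s + s')%N; rewrite natrD; pose t : R := s%:R + s'%:R; rewrite -/t.
  have s0 : 0 <= s%:R :> R by [].
  have s'0 : 0 <= s'%:R :> R by [].
  have h1 : t * alpha + beta < - 1.
    have hst : (`|beta| + 1) / - alpha < t by rewrite (lt_le_trans hs)// /t lerDl.
    have : `|beta| + 1 < t * - alpha by rewrite -ltr_pdivrMr//; lra.
    have := ler_norm beta; lra.
  have : t * (t * alpha + beta) <= - t.
    rewrite -mulrN1 ler_wpM2l//; first by rewrite /t; lra.
    exact: ltW.
  have := ler_norm c; have := ler_norm (- b); rewrite normrN.
  rewrite mulrDr mulrA -expr2 /t; lra.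
pose s := Num.bound ((`|c| + `|b|) / - beta).
have hs : (`|c| + `|b|) / - beta < s%:R.
  by apply: archi_boundP; apply: divr_ge0; lra.
exists s.
have : `|c| + `|b| < s%:R * - beta by rewrite -ltr_pdivrMr//; lra.
have := ler_norm c; have := ler_norm (- b); rewrite normrN; lra.
Qed.

(* The minimizer is [u = - H^+ g]; the hypothesis is solvability of [H u = - g]. *)
Lemma quad_linear_min (R : realType) (l : nat) (H : 'M[R]_l) (g u u0 : 'cV[R]_l) :
  H^T = H -> (forall v, 0 <= quad H v) -> H *m u0 = - g ->
  quad H u0 + 2 * bilin 1%:M u0 g <= quad H u + 2 * bilin 1%:M u g.
Proof.
move=> Hs Hp Hu0; have -> : g = - (H *m u0) by rewrite Hu0 opprK.
have e v : bilin 1%:M v (- (H *m u0)) = - bilin H v u0.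
  by rewrite -scaleN1r bilinZr mulN1r /bilin mulmx1 mulmxA.
(* Completing the square: the difference of the two sides is [quad H (u - u0)]. *)
have := Hp (u + (-1) *: u0).
rewrite !e !quadE !(bilinDl, bilinDr, bilinZl, bilinZr).
rewrite -[bilin H u0 u]bilin_tr Hs; lra.
Qed.

(** * Dynamic programming for the deterministic cost-to-go *)

Section cost_to_go.
Context {R : realType} {n l p q : nat}.
Variables (A : 'I_q -> 'M[R]_n) (B : 'I_p -> 'M[R]_(n, l)) (pi : 'I_q -> R).
Variables (M : 'M[R]_n) (W : 'M[R]_l) (Q : 'M[R]_n).

(** Expected cost from a deterministic state, with the first mode averaged out. Time restarts at 0
    after each step, so the sequences [a] and [K] are shifted instead of carrying a time index. *)
Fixpoint cost_to_go (a : nat -> 'I_p) (K : @feedback R n l) N (x : 'cV[R]_n) : R :=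
  if N is N'.+1 then
    quad M x + quad W (K 0%N x *m x) +
    \sum_e pi e * cost_to_go (fun k => a k.+1) (fun k => K k.+1) N'
                    (A e *m x + B (a 0%N) *m (K 0%N x *m x))
  else quad Q x.

Lemma cost_to_go0 a K N : cost_to_go a K N 0 = 0.
Proof.
elim: N a K => [|N IH] a K /=; first by rewrite quad0.
rewrite !mulmx0 !quad0 !addr0 add0r big1// => e _.
by rewrite !mulmx0 addr0 IH mulr0.
Qed.

Definition gain_cons (K : 'M[R]_(l, n)) (F : nat -> 'M[R]_(l, n)) k :=
  if k is j.+1 then F j else K.

Hypothesis pi_ge0 : forall e, 0 <= pi e.
Hypothesis pi_sum : \sum_e pi e = 1.

(** With [lq_cross] and [lq_free], the coefficients of the Riccati recursion: the parts of the
    averaged one-step cost that are quadratic in [u], bilinear in [u] and [x], and quadratic in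
    [x]. *)
Definition lq_hess (S : 'M[R]_n) (b : 'I_p) : 'M[R]_l :=
  symmx (W + (B b)^T *m S *m B b).
Definition lq_cross (S : 'M[R]_n) (b : 'I_p) : 'M[R]_(l, n) :=
  \sum_e pi e *: ((B b)^T *m S *m A e).
Definition lq_free (S : 'M[R]_n) : 'M[R]_n :=
  \sum_e pi e *: ((A e)^T *m S *m A e).

Lemma one_step (S : 'M[R]_n) b x u : S^T = S ->
  quad W u + \sum_e pi e * quad S (A e *m x + B b *m u) =
  quad (lq_free S) x + (quad (lq_hess S b) u + 2 * bilin 1%:M u (lq_cross S b *m x)).
Proof.
move=> Ss; rewrite quad_symmx !quadE bilinD -bilin_mulmx.
have -> : bilin 1%:M u (lq_cross S b *m x) = bilin (lq_cross S b) u x.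
  by rewrite /bilin mulmx1 mulmxA.
rewrite !bilin_sum mulr_sumr.
rewrite (eq_bigr (fun e => (bilin (pi e *: ((A e)^T *m S *m A e)) x x +
   2 * bilin (pi e *: ((B b)^T *m S *m A e)) u x) +
   pi e * bilin S (B b *m u) (B b *m u))).
  by rewrite 2!big_split /= -mulr_suml pi_sum; lra.
move=> e _; rewrite !bilinZ -!bilin_mulmx quadE !(bilinDl, bilinDr).
rewrite -[bilin S (A e *m x) (B b *m u)]bilin_tr Ss; lra.
Qed.

(* A single gain acts on all the states reached along the different modes, so
   the induction needs one gain that works for a whole weighted family. *)
Definition unbounded_on (G : 'cV[R]_n -> Prop) a N (I : Type)
    (F : I -> nat -> 'M[R]_(l, n)) :=
  forall (T : finType) (w : T -> R) (y : T -> 'cV[R]_n),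
    (forall t, 0 <= w t) -> (exists2 t, 0 < w t & ~ G (y t)) ->
    forall b, exists i,
      \sum_t w t * cost_to_go a (linear_feedback (F i)) N (y t) < b.

Lemma cost_to_go_cons a K F N x :
  cost_to_go a (linear_feedback (gain_cons K F)) N.+1 x =
  quad M x + quad W (K *m x) +
    \sum_e pi e * cost_to_go (fun k => a k.+1) (linear_feedback F) N
                    (A e *m x + B (a 0%N) *m (K *m x)).
Proof. by []. Qed.

(** The successors of the family [y] under all modes form a family indexed by pairs, with weights
    [w t * pi e]. Unboundedness of the tail applies to it, and the first-stage cost is a constant
    once [K] is fixed. *)
Lemma unbounded_cons a N G (I : Type) (F : I -> nat -> 'M[R]_(l, n)) K
    (T : finType) (w : T -> R) (y : T -> 'cV[R]_n) :
  unbounded_on G (fun k => a k.+1) N F -> (forall t, 0 <= w t) ->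
  (exists t e, [/\ 0 < w t, 0 < pi e & ~ G (A e *m y t + B (a 0%N) *m (K *m y t))]) ->
  forall b, exists i,
    \sum_t w t * cost_to_go a (linear_feedback (gain_cons K (F i))) N.+1 (y t) < b.
Proof.
move=> unb w0 [t [e [wt pe nG]]] b.
pose c := \sum_t w t * (quad M (y t) + quad W (K *m y t)).
have [||i Hi] := unb _ (fun te : T * 'I_q => w te.1 * pi te.2)
  (fun te => A te.2 *m y te.1 + B (a 0%N) *m (K *m y te.1)) _ _ (b - c).
- by move=> te; rewrite mulr_ge0.
- by exists (t, e) => //=; rewrite mulr_gt0.
exists i.
under eq_bigr do rewrite cost_to_go_cons mulrDr mulr_sumr.
rewrite big_split /= -/c pair_big /= -ltrBDl (le_lt_trans _ Hi)//.
by rewrite le_eqVlt; apply/orP; left; apply/eqP/eq_bigr => te _; rewrite mulrA.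
Qed.

(* [G] is the set of states at which the optimal cost-to-go is finite. *)
Definition riccati_solution a N (G : 'cV[R]_n -> Prop) (S : 'M[R]_n)
    (Kst : nat -> 'M[R]_(l, n)) :=
  [/\ G 0, forall c x y, G x -> G y -> G (c *: x + y), S^T = S,
      forall x, G x -> cost_to_go a (linear_feedback Kst) N x = quad S x &
      forall K x, G x -> quad S x <= cost_to_go a K N x].

(** With first gain [j%:R *: K] and tail [Kst], the weighted cost is [c + j^2 alpha + j beta] as
    long as the successors stay in [G]. The option selects the tail: [None] for [Kst], [Some i] for
    the unbounded family. *)
Lemma unbounded_ray a N G S Kst (I : Type) (F : I -> nat -> 'M[R]_(l, n)) K
    (T : finType) (w : T -> R) (y : T -> 'cV[R]_n) :
  let H := lq_hess S (a 0%N) in let L := lq_cross S (a 0%N) in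
  let alpha := \sum_t w t * quad H (K *m y t) in
  let beta := \sum_t w t * (2 * bilin 1%:M (K *m y t) (L *m y t)) in
  riccati_solution (fun k => a k.+1) N G S Kst ->
  unbounded_on G (fun k => a k.+1) N F -> (forall t, 0 <= w t) ->
  (forall u, G (B (a 0%N) *m u)) ->
  alpha < 0 \/ (alpha = 0 /\ beta < 0) ->
  forall b, exists j (i : option I),
    \sum_t w t * cost_to_go a
      (linear_feedback (gain_cons (j%:R *: K) (if i is Some i' then F i' else Kst)))
      N.+1 (y t) < b.
Proof.
move=> H L alpha beta [G0 Glin Ss Geq _] unb w0 GB neg b.
have [[t [e [wt pe nG]]]|allG] :=
    pselect (exists t e, [/\ 0 < w t, 0 < pi e & ~ G (A e *m y t)]).
  (* A successor leaves [G] already under zero control, so the first gain is switched off. *)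
  exists 0%N; rewrite scale0r.
  have [|i Hi] := unbounded_cons (K := 0) unb w0 (y := y) _ b; last by exists (Some i).
  by exists t, e; split=> //; rewrite mul0mx mulmx0 addr0.
pose c := \sum_t w t * (quad M (y t) + quad (lq_free S) (y t)).
have [j Hj] := lt0_quadratic_unbounded c b neg.
exists j, None; rewrite (le_lt_trans _ Hj)// le_eqVlt; apply/orP; left; apply/eqP.
rewrite /c /alpha /beta !mulr_sumr -!big_split /=; apply: eq_bigr => t _.
have [->|wt] := eqVneq (w t) 0; first by rewrite !mul0r !mulr0 !addr0.
have {}wt : 0 < w t by rewrite lt_neqAle eq_sym wt w0.
rewrite -/(cost_to_go a _ N.+1 _) cost_to_go_cons.
rewrite (eq_bigr (fun e =>
    pi e * quad S (A e *m y t + B (a 0%N) *m (j%:R *: K *m y t)))).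
  rewrite -[quad M _ + quad W _ + _]addrA one_step// -/H -/L -scalemxAl.
  by rewrite !quadE !(bilinZl, bilinZr); ring.
move=> e _; have [->|pe] := eqVneq (pi e) 0; first by rewrite !mul0r.
rewrite Geq// -[A e *m _]scale1r; apply: Glin => //.
apply: contrapT => nG; apply: allG; exists t, e; split=> //.
by rewrite lt_neqAle eq_sym pe pi_ge0.
Qed.

(** Induction on the horizon, with three cases for the first step: some control leads out of the
    next [G]; the Hessian [H] takes a negative value; [H] is positive semidefinite. *)
Lemma exists_riccati_solution a N :
  exists G S Kst (I : countType) (F : I -> nat -> 'M[R]_(l, n)),
  riccati_solution a N G S Kst /\ unbounded_on G a N F.
Proof.
elim: N a => [|N IH] a.
  (* With no step left the cost is finite everywhere, and unboundedness outside [G] is vacuous. *)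
  exists (fun=> True), (symmx Q), (fun=> 0), unit, (fun _ _ => 0); split.
    by split=> // *; rewrite ?symmx_sym ?quad_symmx.
  by move=> T w y w0 [].
have [G [S [Kst [I [F [sol unb]]]]]] := IH (fun k => a k.+1).
have [G0 Glin Ss Geq Gle] := sol.
have GZ c x : G x -> G (c *: x) by move=> Gx; rewrite -[_ *: _]addr0; exact: Glin.
have GN c x : c != 0 -> ~ G x -> ~ G (c *: x).
  by move=> c0 nGx /(GZ c^-1); rewrite scalerA mulVf ?scale1r.
have nz T (w : T -> R) (y : T -> 'cV[R]_n) :
    (exists2 t, 0 < w t & y t <> 0) -> exists t c, 0 < w t /\ y t c 0 != 0.
  move=> [t wt yt]; apply: contrapT => h; apply: yt; apply/colP => c; rewrite mxE.
  by apply/eqP; apply: contrapT => ytc; apply: h; exists t, c; split=> //; apply/negP.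
(* Shared by the two degenerate cases, where only the state 0 has finite cost. *)
have sol0 : riccati_solution a N.+1 (fun x => x = 0) 0 (fun=> 0).
  split=> //.
  - by move=> c x y -> ->; rewrite scaler0 addr0.
  - by rewrite trmx0.
  - by move=> x ->; rewrite cost_to_go0 quad0.
  - by move=> K x ->; rewrite cost_to_go0 quad0.
(* The rank-one gain reads coordinate [c] of the state and acts along [v]. A nonzero state has some
   nonzero coordinate, so finitely many such gains are enough. *)
have coordE (v : 'cV[R]_l) c (x : 'cV[R]_n) : v *m delta_mx 0 c *m x = x c 0 *: v.
  rewrite -mulmxA -rowE; apply/colP => i; rewrite !mxE big_ord1 !mxE mulrC.
  by congr (_ * _); congr (x _ _); apply: val_inj.
have [e0 pe0] : exists e, 0 < pi e.
  apply: contrapT => h; have := oner_neq0 R; rewrite -pi_sum big1 ?eqxx// => e _.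
  apply/eqP; rewrite eq_le pi_ge0 andbT leNgt; apply/negP => pe.
  by apply: h; exists e.
have [[u nGu]|] := pselect (exists u, ~ G (B (a 0%N) *m u)).
  exists (fun x => x = 0), 0, (fun=> 0), (option 'I_n * I)%type.
  exists (fun ci =>
    gain_cons (if ci.1 is Some c then u *m delta_mx 0 c else 0) (F ci.2)).
  split=> // T w y w0 /nz[t [c [wt ytc]]] b.
  (* [G] is a subspace without [B u]: if [A e0 y] lies in it, adding a nonzero multiple of [B u]
     leaves it; if not, the zero gain already does. *)
  have [GA|nGA] := pselect (G (A e0 *m y t)); last first.
    have [|i Hi] := unbounded_cons (K := 0) unb w0 (y := y) _ b;
      last by exists (None, i).
    by exists t, e0; split=> //; rewrite mul0mx mulmx0 addr0.
  have [|i Hi] := unbounded_cons (K := u *m delta_mx 0 c) unb w0 (y := y) _ b;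
    last by exists (Some c, i).
  exists t, e0; split=> //; rewrite coordE -scalemxAr => GAB.
  apply: (GN _ _ ytc nGu).
  by rewrite -[_ *: _](addKr (A e0 *m y t)) -scaleN1r; exact: Glin.
move=> /forallNP GB'; have GB u : G (B (a 0%N) *m u) by apply: contrapT; exact: GB'.
set H := lq_hess S (a 0%N); set L := lq_cross S (a 0%N).
(* Second case: pushing along [v] makes the coefficient [alpha] of the ray negative. *)
have [[v Hv]|] := pselect (exists v, quad H v < 0).
  exists (fun x => x = 0), 0, (fun=> 0), ('I_n * nat * option I)%type.
  exists (fun cji => gain_cons (cji.1.2%:R *: (v *m delta_mx 0 cji.1.1))
           (if cji.2 is Some i then F i else Kst)).
  split=> // T w y w0 /nz[t [c [wt ytc]]] b.
  have [|j [i Hi]] := unbounded_ray (K := v *m delta_mx 0 c) (y := y) sol unb w0 GB _ b;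
    last by exists (c, j, i).
  have sqE t' : quad H (v *m delta_mx 0 c *m y t') = y t' c 0 ^+ 2 * quad H v.
    by rewrite coordE !quadE bilinZl bilinZr mulrA expr2.
  left; rewrite -/H (bigD1 t)//= sqE ltr_wnDr//.
    apply: sumr_le0 => t' _; rewrite sqE mulr_ge0_le0// mulr_ge0_le0// ?sqr_ge0//.
    exact: ltW.
  by rewrite pmulr_rlt0// pmulr_rlt0// lt_neqAle eq_sym sqrf_eq0 ytc sqr_ge0.
move=> /forallNP Hpos'; have Hpos v : 0 <= quad H v.
  by rewrite leNgt; apply/negP; exact: Hpos'.
have Hs : H^T = H by exact: symmx_sym.
(* [pinvmx] solves row systems, hence the transposes; [H] being symmetric, [K0 x] solves
   [H u = - L x] whenever [L x] is in the range of [H]. *)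
pose K0 : 'M[R]_(l, n) := - ((pinvmx H)^T *m L).
pose G1 x := (forall e, 0 < pi e -> G (A e *m x)) /\ ((L *m x)^T <= H)%MS.
(* The one-step cost at [u = K0 x], written as a symmetric form in [x]. *)
pose S1 := symmx (M + lq_free S + (K0^T *m H *m K0 + 2 *: (K0^T *m L))).
have HK0 x : G1 x -> H *m (K0 *m x) = - (L *m x).
  move=> [_ Lx]; rewrite /K0 mulNmx mulmxN -mulmxA; congr (- _).
  by rewrite -[RHS]trmxK -(mulmxKpV Lx) [RHS]trmx_mul [in RHS]trmx_mul Hs trmxK.
have S1E x : quad S1 x = quad M x + quad (lq_free S) x +
    (quad H (K0 *m x) + 2 * bilin 1%:M (K0 *m x) (L *m x)).
  rewrite quad_symmx !quadE !bilinD bilinZ !bilin_mulmx.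
  by rewrite mulmx1.
have nextG x u e : G1 x -> 0 < pi e -> G (A e *m x + B (a 0%N) *m u).
  by move=> [GA _] pe; rewrite -[A e *m _]scale1r; apply: Glin; [exact: GA|exact: GB].
(* Along [u = - Z Z^T L x] the quadratic part vanishes and the linear part is
   [- |Z^T L x|^2], negative unless [L x] is in the range of [H]. *)
have [Z HZ0 HZ1] : exists2 Z : 'M[R]_l, H *m Z = 0 &
    forall z : 'rV_l, z *m Z = 0 -> (z <= H)%MS.
  exists (cokermx H); first exact: mulmx_coker.
  by move=> z zZ; rewrite submxE zZ.
exists G1, S1, (gain_cons K0 Kst), (nat * option I)%type.
exists (fun ji => gain_cons (ji.1%:R *: (- (Z *m Z^T *m L)))
                    (if ji.2 is Some i then F i else Kst)).
split.
  split.
  - by split=> [e _|]; rewrite mulmx0 ?trmx0 ?sub0mx.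
  - move=> c x y [GAx Lx] [GAy Ly]; split=> [e pe|]; rewrite mulmxDr -scalemxAr.
      by apply: Glin; [exact: GAx|exact: GAy].
    by rewrite linearD linearZ /= addmx_sub// scalemx_sub.
  - exact: symmx_sym.
  - move=> x Gx; rewrite cost_to_go_cons S1E -!addrA -one_step//.
    congr (_ + (_ + _)); apply: eq_bigr => e _.
    have [->|pe] := eqVneq (pi e) 0; first by rewrite !mul0r.
    by rewrite Geq//; apply: nextG => //; rewrite lt_neqAle eq_sym pe pi_ge0.
  - move=> K x Gx /=; set u := K 0%N x *m x.
    (* Bellman inequality: the tail costs at least [S] at the next state, and [K0 x] minimizes the
       resulting one-step cost. *)
    apply: (@le_trans _ _ (quad M x + (quad W u +
        \sum_e pi e * quad S (A e *m x + B (a 0%N) *m u)))).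
      rewrite one_step// S1E -!addrA lerD2l lerD2l.
      by apply: quad_linear_min => //; exact: HK0.
    rewrite -addrA lerD2l lerD2l; apply: ler_sum => e _.
    have [->|pe] := eqVneq (pi e) 0; first by rewrite !mul0r.
    rewrite ler_wpM2l//; apply: Gle; apply: nextG => //.
    by rewrite lt_neqAle eq_sym pe pi_ge0.
move=> T w y w0 [t wt nGt] b.
have [[t' [e [wt' pe nG]]]|allG] :=
    pselect (exists t e, [/\ 0 < w t, 0 < pi e & ~ G (A e *m y t)]).
  have [|i Hi] := unbounded_cons (K := 0) unb w0 (y := y) _ b.
    by exists t', e; split=> //; rewrite mul0mx mulmx0 addr0.
  by exists (0%N, Some i); rewrite /= scale0r.
(* All successors stay in [G], so a state outside [G1] must fail the range condition. *)
have nLt : ~ ((L *m y t)^T <= H)%MS.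
  move=> Lt; apply: nGt; split=> // e pe; apply: contrapT => nG.
  by apply: allG; exists t, e.
pose K1 := - (Z *m Z^T *m L).
have [|j [i Hi]] := unbounded_ray (K := K1) (y := y) sol unb w0 GB _ b;
  last by exists (j, i).
right; rewrite -/H -/L.
have HZ x : H *m (K1 *m x) = 0.
  by rewrite /K1 mulNmx mulmxN -!mulmxA mulmxA HZ0 mul0mx oppr0.
have crossE x : bilin 1%:M (K1 *m x) (L *m x) =
    - bilin 1%:M (Z^T *m (L *m x)) (Z^T *m (L *m x)).
  have -> : K1 *m x = -1 *: (Z *m (Z^T *m (L *m x))).
    by rewrite /K1 mulNmx scaleN1r !mulmxA.
  by rewrite bilinZl mulN1r /bilin !mulmx1 [in LHS]trmx_mul -mulmxA.
have cross_le0 x : bilin 1%:M (K1 *m x) (L *m x) <= 0.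
  rewrite crossE oppr_le0; have [->|/bilin_1_gt0/ltW//] := eqVneq (Z^T *m (L *m x)) 0.
  by rewrite bilin0r.
split.
  by rewrite big1// => t' _; rewrite /quad -mulmxA HZ mulmx0 mxE mulr0.
rewrite (bigD1 t)//= ltr_wnDr//.
  by apply: sumr_le0 => t' _; rewrite mulr_ge0_le0// mulr_ge0_le0.
rewrite pmulr_rlt0// pmulr_rlt0// crossE oppr_lt0; apply: bilin_1_gt0.
apply: contra_notN nLt => /eqP ZL0; apply: HZ1.
by rewrite -[LHS]trmxK trmx_mul trmxK ZL0 trmx0.
Qed.

End cost_to_go.

(** * Averaging path costs over finite mode sequences *)

Section path_costs.
Context {R : realType} {n l p q : nat}.
Variables (A : 'I_q -> 'M[R]_n) (B : 'I_p -> 'M[R]_(n, l)) (pi : 'I_q -> R).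
Variables (M : 'M[R]_n) (W : 'M[R]_l) (Q : 'M[R]_n).
Implicit Types (a : nat -> 'I_p) (K : @feedback R n l) (s : nat -> 'I_q).

(** [state] adds steps at the end, [cost_to_go] removes them at the front; this reconciles the two
    recursions. *)
Lemma state_shift a K x s k :
  state A B a K x s k.+1 =
  state A B (fun k => a k.+1) (fun k => K k.+1)
    (A (s 0%N) *m x + B (a 0%N) *m (K 0%N x *m x)) (fun k => s k.+1) k.
Proof. by elim: k => [//|k IH]; rewrite [LHS]/= -/(state A B a K x s k.+1) IH. Qed.

Lemma path_cost_shift a N K x s :
  path_cost A B a M W Q N.+1 K x s =
  quad M x + quad W (K 0%N x *m x) +
  path_cost A B (fun k => a k.+1) M W Q N (fun k => K k.+1)
    (A (s 0%N) *m x + B (a 0%N) *m (K 0%N x *m x)) (fun k => s k.+1).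
Proof.
rewrite /path_cost big_ord_recl state_shift -!addrA; congr (_ + (_ + (_ + _))).
by apply: eq_bigr => k _; rewrite /control lift0 state_shift.
Qed.

Lemma eq_path_cost a N K x s s' : (forall k, (k < N)%N -> s k = s' k) ->
  path_cost A B a M W Q N K x s = path_cost A B a M W Q N K x s'.
Proof.
move=> ss'; have st k : (k <= N)%N -> state A B a K x s k = state A B a K x s' k.
  by elim: k => [//|k IH] kN /=; rewrite IH ?ss'// ltnW.
rewrite /path_cost st//; congr (_ + _).
by apply: eq_bigr => k _; rewrite /control !st// ltnW.
Qed.

Lemma big_tuple_cons (I : finType) N (F : N.+1.-tuple I -> R) :
  \sum_t F t = \sum_i \sum_(t : N.-tuple I) F [tuple of i :: t].
Proof.
rewrite pair_big /= (reindex (fun it : I * N.-tuple I => [tuple of it.1 :: it.2]))//=.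
exists (fun t => (thead t, [tuple of behead t])) => [[i t] _|t _] /=.
  by rewrite theadE; congr (_, _); apply: val_inj.
by rewrite [RHS]tuple_eta.
Qed.

Lemma big_tuple0 (I : finType) (F : 0.-tuple I -> R) : \sum_t F t = F [tuple].
Proof. by rewrite (big_pred1 [tuple])// => t; apply/esym/eqP; exact: tuple0. Qed.

Hypothesis pi_sum : \sum_e pi e = 1.

Lemma sum_tuple_prod N : \sum_(t : N.-tuple 'I_q) \prod_(e <- t) pi e = 1.
Proof.
elim: N => [|N IH].
  by rewrite big_tuple0 big_nil.
rewrite big_tuple_cons -[RHS]pi_sum; apply: eq_bigr => e _.
by under eq_bigr do rewrite big_cons; rewrite -mulr_sumr IH mulr1.
Qed.

(** Splitting off the first mode of the tuple gives the recursion of [cost_to_go]; the first-stage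
    cost does not depend on the modes and the weights sum to 1. *)
Lemma sum_path_cost e0 a N K x :
  \sum_(t : N.-tuple 'I_q)
    (\prod_(e <- t) pi e) * path_cost A B a M W Q N K x (nth e0 t) =
  cost_to_go A B pi M W Q a K N x.
Proof.
elim: N a K x => [|N IH] a K x.
  by rewrite big_tuple0 big_nil mul1r /path_cost big_ord0 add0r.
rewrite big_tuple_cons /= -[X in X + _]mul1r -[X in X * _ + _]pi_sum.
rewrite mulr_suml -big_split /=.
apply: eq_bigr => e _; rewrite -IH.
under eq_bigr do rewrite path_cost_shift big_cons -mulrA mulrDr /=.
by rewrite -mulr_sumr big_split /= -mulr_suml sum_tuple_prod mul1r mulrDr.
Qed.

End path_costs.

(** * Borel measurability of matrix-valued maps, states and costs *)

Local Notation mxB R m n :=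
  (g_sigma_algebraType [set U : set 'M[R]_(m, n) | open U]).

Section borel_matrices.
Context {R : realType}.

Lemma measurable_coord m n i j :
  measurable_fun setT (fun x : mxB R m n => (x : 'M[R]_(m, n)) i j : R).
Proof.
apply: (measurability _ (RGenOpens.measurableE R)) => _ [_ [u [v ->] <-]].
rewrite setTI; apply: sub_sigma_algebra => /=.
by move/continuousP : (@coord_continuous R m n i j); apply; exact: interval_open.
Qed.

(** An open set is the countable union of the boxes with rational centre and radius [1/(k+1)] inside
    it, and each box is a finite intersection of coordinate conditions. *)
Lemma measurable_fun_mx d (T : measurableType d) m n (f : T -> mxB R m n) :
  (forall i j, measurable_fun setT (fun t => (f t : 'M[R]_(m, n)) i j : R)) ->
  measurable_fun setT f.
Proof.
move=> mf; apply: (@measurability _ _ T (mxB R m n) setT f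
  [set U : set 'M[R]_(m, n) | open U] erefl) => _ [U oU <-].
rewrite setTI.
pose box (ck : 'M[rat]_(m, n) * nat) : set 'M[R]_(m, n) :=
  [set x | forall i j, `|x i j - ratr (ck.1 i j)| < ck.2.+1%:R^-1].
rewrite (_ : _ @^-1` _ =
    \bigcup_ck (if `[< box ck `<=` U >] then f @^-1` box ck else set0)).
  apply: countable_bigcupT_measurable => // ck.
  case: asboolP => // _.
  rewrite (_ : _ @^-1` _ = \bigcap_(ij in [set: 'I_m * 'I_n])
      ((fun t => (f t : 'M[R]_(m, n)) ij.1 ij.2) @^-1`
        ball (ratr (ck.1 ij.1 ij.2) : R) ck.2.+1%:R^-1)).
    apply: fin_bigcap_measurable => // ij _.
    by rewrite -[X in measurable X]setTI; apply: mf => //; exact: measurable_ball.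
  apply/seteqP; split => t /= ht.
    by move=> [i j] _; rewrite /= /ball /= distrC; exact: ht.
  by move=> i j; have := ht (i, j) Logic.I; rewrite /= /ball /= distrC.
apply/seteqP; split => [t Ut|t [ck _]]; last first.
  by case: asboolP => // + bt; apply.
have /nbhs_ballP[e /= e0 eU] : nbhs (f t : 'M[R]_(m, n)) U by exact: open_nbhs_nbhs.
(* Two radii are needed: one from [f t] to the rational centre, one from the centre to a point of
   the box. *)
have [k ke] : exists k, k.+1%:R^-1 + k.+1%:R^-1 < e.
  have [k hk] : exists k, k.+1%:R^-1 < e / 2.
    exists (Num.bound (e / 2)^-1); rewrite invf_plt ?posrE ?divr_gt0//.
    by rewrite (lt_trans (archi_boundP _)) ?invr_ge0 ?divr_ge0 ?ltW// ltr_nat.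
  by exists k; rewrite [ltRHS]splitr ltrD.
have k0 : 0 < k.+1%:R^-1 :> R by rewrite invr_gt0.
have approx (z v : R) : 0 < v -> exists r : rat, `|z - ratr r| < v.
  move=> v0; have /rat_in_itvoo[r] : z - v < z + v by lra.
  rewrite in_itv /= => /andP[h1 h2].
  by exists r; rewrite ltr_norml; apply/andP; split; lra.
pose c : 'M[rat]_(m, n) := \matrix_(i, j) xchoose (approx (f t i j) _ k0).
have cP i j : `|(f t : 'M[R]_(m, n)) i j - ratr (c i j)| < k.+1%:R^-1.
  by rewrite mxE; exact: (xchooseP (approx (f t i j) _ k0)).
exists (c, k) => //; case: asboolP => // -[] x xb; apply: eU; split=> // i j.
rewrite /ball /= -(subrKA (ratr (c i j))) (le_lt_trans (ler_normD _ _))//.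
by rewrite (lt_trans _ ke)// ltrD// distrC; exact: xb.
Qed.

Lemma measurable_mulmx d (T : measurableType d) m k n
    (f : T -> mxB R m k) (g : T -> mxB R k n) :
  measurable_fun setT f -> measurable_fun setT g ->
  measurable_fun setT (fun t =>
    (f t : 'M[R]_(m, k)) *m (g t : 'M[R]_(k, n)) : mxB R m n).
Proof.
move=> mf mg; apply: measurable_fun_mx => i j.
under eq_fun do rewrite mxE.
apply: measurable_sum => h; apply: measurable_funM.
  exact: (measurableT_comp (measurable_coord i h) mf).
exact: (measurableT_comp (measurable_coord h j) mg).
Qed.

Lemma measurable_addmx d (T : measurableType d) m n (f g : T -> mxB R m n) :
  measurable_fun setT f -> measurable_fun setT g ->
  measurable_fun setT (fun t =>
    (f t : 'M[R]_(m, n)) + (g t : 'M[R]_(m, n)) : mxB R m n).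
Proof.
move=> mf mg; apply: measurable_fun_mx => i j.
under eq_fun do rewrite mxE.
by apply: measurable_funD; apply: (measurableT_comp (measurable_coord i j)).
Qed.

Lemma measurable_trmx d (T : measurableType d) m n (f : T -> mxB R m n) :
  measurable_fun setT f ->
  measurable_fun setT (fun t => (f t : 'M[R]_(m, n))^T : mxB R n m).
Proof.
move=> mf; apply: measurable_fun_mx => i j.
under eq_fun do rewrite mxE.
exact: (measurableT_comp (measurable_coord j i) mf).
Qed.

Lemma measurable_quad d (T : measurableType d) m (S : 'M[R]_m) (f : T -> mxB R m 1) :
  measurable_fun setT f -> measurable_fun setT (fun t => quad S (f t) : R).
Proof.
move=> mf; apply: (measurableT_comp (measurable_coord 0 0)).
apply: measurable_mulmx => //; apply: measurable_mulmx; last exact: measurable_cst.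
exact: measurable_trmx.
Qed.

Context {n l p q : nat}.
Variables (A : 'I_q -> 'M[R]_n) (B : 'I_p -> 'M[R]_(n, l)) (a : nat -> 'I_p).
Variables (M : 'M[R]_n) (W : 'M[R]_l) (Q : 'M[R]_n) (N : nat).
Variables (K : @feedback R n l) (s : nat -> 'I_q).
Hypothesis admK : admissible N K.

Lemma measurable_feedback d (T : measurableType d) k (f : T -> mxB R n 1) : (k < N)%N ->
  measurable_fun setT f ->
  measurable_fun setT (fun t => K k (f t) *m (f t : 'cV[R]_n) : mxB R l 1).
Proof.
move=> kN mf; apply: measurable_mulmx => //.
have mK : measurable_fun setT (K k : mxB R n 1 -> mxB R l n).
  by move=> _ U mU; apply: (admK kN); exists U.
exact: (measurableT_comp mK mf).
Qed.

Lemma measurable_state k : (k <= N)%N ->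
  measurable_fun setT (fun x : mxB R n 1 => state A B a K x s k : mxB R n 1).
Proof.
elim: k => [_|k IH kN] /=; first exact: measurable_id.
have mk := IH (ltnW kN); apply: measurable_addmx.
  by apply: measurable_mulmx => //; exact: measurable_cst.
by apply: measurable_mulmx; [exact: measurable_cst|exact: measurable_feedback].
Qed.

Lemma measurable_path_cost :
  measurable_fun setT (fun x : mxB R n 1 => path_cost A B a M W Q N K x s : R).
Proof.
have mst k : (k <= N)%N -> _ := @measurable_state k.
apply: measurable_funD; last by apply: measurable_quad; exact: mst.
apply: measurable_sum => k; have kN := ltn_ord k; have mk := mst k (ltnW kN).
by apply: measurable_funD; apply: measurable_quad => //; exact: measurable_feedback.
Qed.

End borel_matrices.

(** * Existence and uniqueness of conditional expectations given [X] *)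

Section conditional_expectations.
Context {d d' : measure_display} {Omega : measurableType d} {T : measurableType d'}.
Context {R : realType}.
Variables (P : probability Omega R) (X : {mfun Omega >-> T}).

Let GX : set (set Omega) := preimage_set_system setT X measurable.

Let mpre (U : set T) : measurable U -> measurable (X @^-1` U).
Proof. by move=> mU; rewrite -[X in measurable X]setTI; exact: measurable_funP. Qed.

Section independent_event.
Variable F : set Omega.
Hypotheses (mF : measurable F) (indF : forall E, GX E -> P (E `&` F) = (P E * P F)%E).

(** By independence, the law of [X] under [P] restricted to [F] is [P F] times its law under [P]. *)
Lemma ge0_integral_indep (U : set T) (g : T -> \bar R) : measurable U ->
  measurable_fun U g -> (forall x, U x -> 0 <= g x)%E ->
  (\int[P]_(w in X @^-1` U `&` F) g (X w) = P F * \int[P]_(w in X @^-1` U) g (X w))%E.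
Proof.
move=> mU mg g0; have mXU := mpre mU.
have gU : {in U, forall y, (0 <= g y)%E} by move=> y; rewrite inE; exact: g0.
have mgX : measurable_fun (X @^-1` U) (g \o X).
  apply: (measurable_comp mU) => //; first by move=> _ [w Uw <-].
  exact: measurable_funTS.
have PF : P F \is a fin_num by exact: fin_num_measure.
pose c : {nonneg R} := NngNum (fine_ge0 (measure_ge0 P F)).
have cE : c%:num%:E = P F by rewrite /= fineK.
rewrite -cE -(ge0_integral_pushforward (phi := X) _ P mU mg gU)//.
rewrite -ge0_integral_mscale//.
transitivity (\int[pushforward (mrestr P mF) X]_(y in U) g y)%E; last first.
  apply: eq_measure_integral => V mV _; rewrite /= /mscale /= /pushforward.
  by rewrite /mrestr fineK// muleC indF//; exists V => //; rewrite setTI.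
rewrite ge0_integral_pushforward//.
rewrite [RHS](@ge0_negligible_integral _ _ _ _ _ (~` F))//; first last.
- by rewrite /= /mrestr setICl measure0.
- by move=> w /= Uw; exact: g0.
- exact: measurableC.
rewrite setDE setCK; apply: eq_measure_integral => V mV VF.
rewrite /=.
by rewrite /mrestr/= setIidl// => w /VF[].
Qed.

Lemma integral_indep (U : set T) (g : T -> \bar R) : measurable U ->
  measurable_fun U g -> P.-integrable (X @^-1` U) (g \o X) ->
  (\int[P]_(w in X @^-1` U `&` F) g (X w) = P F * \int[P]_(w in X @^-1` U) g (X w))%E.
Proof.
move=> mU mg ig; rewrite integralE [in RHS]integralE.
have PF : P F \is a fin_num by exact: fin_num_measure.
have fin_pos := integrable_pos_fin_num (mpre mU) ig.
have fin_neg := integrable_neg_fin_num (mpre mU) ig.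
rewrite muleBr//; last exact: fin_num_adde_defr.
rewrite (funepos_comp g X) (funeneg_comp g X); congr (_ - _)%E.
  by apply: ge0_integral_indep => //; exact: measurable_funepos.
by apply: ge0_integral_indep => //; exact: measurable_funeneg.
Qed.

End independent_event.

(** Independence replaces each indicator by its probability. The exhausting events are those where
    every [g i (X w)] is bounded by [j], which makes all the integrals finite. *)
Lemma is_cond_exp_finite (I : finType) (F : I -> set Omega) (g : I -> T -> R)
    (Z : Omega -> R) :
  (forall i, measurable (F i)) ->
  (forall i E, GX E -> P (E `&` F i) = (P E * P (F i))%E) ->
  (forall i, measurable_fun setT (g i)) ->
  (forall w, Z w = \sum_i \1_(F i) w * g i (X w)) ->
  is_cond_exp P GX Z (fun w => \sum_i fine (P (F i)) * g i (X w)).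
Proof.
move=> mF indF mg ZE.
pose h x := \sum_i fine (P (F i)) * g i x.
have mh : measurable_fun setT h.
  by apply: measurable_sum => i; apply: measurable_funM.
have mgX i : measurable_fun setT (g i \o X) by exact: measurableT_comp.
pose D j : set T := \bigcap_(i in [set: I]) [set x | `|g i x| <= j%:R].
have mD j : measurable (D j).
  apply: fin_bigcap_measurable => // i _.
  rewrite (_ : [set _ | _] = (g i) @^-1` `[- j%:R, j%:R]%classic).
    by rewrite -[X in measurable X]setTI; exact: mg.
  by apply/seteqP; split => x /=; rewrite in_itv /= ler_norml.
have mXD j : measurable (X @^-1` D j) by exact: mpre.
have int1 j i E : measurable E -> E `<=` X @^-1` D j ->
    P.-integrable E (EFin \o (g i \o X)).
  move=> mE ED; apply: measurable_bounded_integrable => //.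
  - by rewrite (le_lt_trans (probability_le1 P mE))// ltry.
  - exact: measurable_funTS.
  - exists j%:R; split=> // c jc w Ew /=; rewrite (le_trans _ (ltW jc))//.
    exact: (ED _ Ew i Logic.I).
have int2 j i E : measurable E -> E `<=` X @^-1` D j ->
    P.-integrable E (EFin \o (fun w => \1_(F i) w * g i (X w))).
  move=> mE ED; apply: measurable_bounded_integrable => //.
  - by rewrite (le_lt_trans (probability_le1 P mE))// ltry.
  - apply: measurable_funM; first exact: measurable_indic.
    exact: measurable_funTS (mgX i).
  - exists j%:R; split=> // c jc w Ew /=; rewrite (le_trans _ (ltW jc))//.
    rewrite normrM indicE; case: (w \in F i); rewrite ?normr1 ?normr0 ?mul1r ?mul0r//.
    exact: (ED _ Ew i Logic.I).
have ZEe : EFin \o Z = (fun w => \sum_i (\1_(F i) w * g i (X w))%:E)%E.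
  by apply/funext => w /=; rewrite ZE sumEFin.
have hEe : EFin \o (h \o X) =
    (fun w => \sum_i ((fine (P (F i)))%:E * (g i (X w))%:E))%E.
  by apply/funext => w /=; rewrite /h -sumEFin.
split.
  move=> _ [V mV <-]; exists (h @^-1` V); last by rewrite !setTI.
  by rewrite -[X in measurable X]setTI; exact: mh.
exists (fun j => X @^-1` D j); split.
- by move=> j; exists (D j) => //; rewrite setTI.
- move=> j k jk; apply/subsetPset => w Dw i _ /=.
  by rewrite (le_trans (Dw i Logic.I))// ler_nat.
- apply/seteqP; split => // w _; pose s := \sum_i `|g i (X w)|.
  exists (Num.bound s) => // i _ /=.
  apply: (@le_trans _ _ s); first by rewrite /s (bigD1 i)//= lerDl sumr_ge0.
  by apply/ltW/archi_boundP; exact: sumr_ge0.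
- move=> j; split.
    by rewrite ZEe; apply: integrable_sum => // i _; exact: (int2 j).
  rewrite (_ : (fun w => _) = h \o X)// hEe; apply: integrable_sum => // i _.
  by apply: integrableZl => //; exact: (int1 j).
- move=> j _ [U mU <-]; rewrite setTI => UD; have mXU := mpre mU.
  rewrite -/(EFin \o Z) -/(EFin \o (h \o X)).
  under eq_integral => w _ do rewrite -[(Z w)%:E]/((EFin \o Z) w) ZEe.
  under [RHS]eq_integral => w _ do rewrite -[(_)%:E]/((EFin \o (h \o X)) w) hEe.
  rewrite integral_sum//; last by move=> i; exact: (int2 j).
  rewrite integral_sum//; last first.
    by move=> i; apply: integrableZl => //; exact: (int1 j).
  apply: eq_bigr => i _; rewrite integralZl//; last exact: (int1 j).
  rewrite fineK ?fin_num_measure//.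
  rewrite -(@integral_indep (F i) _ _ U (EFin \o g i))//; last 3 first.
  + exact: indF.
  + by apply/measurable_EFinP; exact: measurable_funTS.
  + exact: (int1 j).
  rewrite integral_mkcondr; apply: eq_integral => w _.
  rewrite /patch indicE; case: (w \in F i); by rewrite ?mul1r ?mul0r.
Qed.

(** The event where [Y2 < Y1], cut by one exhausting event of each version, is in [GX]. Both
    versions have the same integral there, so it is null, and countably many such pieces cover
    it. *)
Lemma is_cond_exp_le (Z Y1 Y2 : Omega -> R) :
  is_cond_exp P GX Z Y1 -> is_cond_exp P GX Z Y2 -> {ae P, forall w, Y1 w <= Y2 w}.
Proof.
move=> [mY1 [D1 [GD1 _ D1T int1 eq1]]] [mY2 [D2 [GD2 _ D2T int2 eq2]]].
pose S := [set w | Y2 w < Y1 w].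
have GXm E : GX E -> measurable E by move=> [U mU <-]; rewrite setTI; exact: mpre.
have GI E E' : GX E -> GX E' -> GX (E `&` E').
  move=> [U mU <-] [V mV <-]; exists (U `&` V); first exact: measurableI.
  by rewrite !setTI preimage_setI.
have GS : GX S.
  (* Both versions are measurable for the sigma-algebra generated by [X], so comparing them gives an
     event of [GX]. *)
  pose O' := g_sigma_algebra_preimageType X.
  have mf (Y : Omega -> R) : preimage_set_system setT Y measurable `<=` GX ->
      measurable_fun setT (Y : O' -> R).
    by move=> h _ V mV; apply: h; exists V.
  have := measurable_fun_ltr (mf _ mY2) (mf _ mY1) measurableT
    (Y := [set true]) Logic.I.
  by rewrite setTI (_ : _ @^-1` _ = S).
have null j k : P (S `&` D1 j `&` D2 k) = 0.
  set E := _ `&` D2 k.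
  have GE : GX E by apply: (GI) => //; exact: GI.
  have mE := GXm _ GE.
  have E1 : E `<=` D1 j by move=> w [[]].
  have E2 : E `<=` D2 k by move=> w [].
  have i1 := integrableS (GXm _ (GD1 j)) mE E1 (int1 j).2.
  have i2 := integrableS (GXm _ (GD2 k)) mE E2 (int2 k).2.
  have mY12 : measurable_fun E (fun w => ((Y1 w)%:E - (Y2 w)%:E)%E).
    by apply: emeasurable_funB; [exact: measurable_int i1|exact: measurable_int i2].
  have [/(_ _)/=] := ae_eq_integral_abs P mE mY12.
  have -> : (\int[P]_(w in E) `|(Y1 w)%:E - (Y2 w)%:E| = 0)%E.
    rewrite (eq_integral (fun w => (Y1 w)%:E - (Y2 w)%:E))%E; last first.
      move=> w; rewrite inE => -[[Sw _] _].
      by rewrite gee0_abs// -EFinB lee_fin subr_ge0 ltW.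
    rewrite integralB_EFin// -(eq1 j E)// -(eq2 k E)// subee//.
    rewrite (eq1 j E)//; exact: integrable_fin_num i1.
  move=> /(_ erefl) [N [mN N0 EN]] _; apply/eqP.
  rewrite -measure_le0 -N0 le_measure ?inE//.
  move=> w Ew; apply: EN => /(_ Ew) /=; rewrite -EFinB => -[] /eqP.
  by rewrite subr_eq0 => /eqP e; have := Ew.1.1; rewrite /S /= e ltxx.
change (P.-negligible (~` [set w | Y1 w <= Y2 w])).
apply: (negligibleS (A := \bigcup_j \bigcup_k (S `&` D1 j `&` D2 k))).
  move=> w /= /negP; rewrite -ltNge => Sw.
  have [j _ D1w] : (\bigcup_j D1 j) w by rewrite D1T.
  have [k _ D2w] : (\bigcup_j D2 j) w by rewrite D2T.
  by exists j => //; exists k.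
apply: negligible_bigcup => j; apply: negligible_bigcup => k.
have mE : measurable (S `&` D1 j `&` D2 k).
  by apply: GXm; apply: (GI) => //; exact: GI.
by apply/negligibleP => //; exact: null.
Qed.

End conditional_expectations.

(** * The conditional cost as the cost-to-go at the initial state *)

Section costs.
Context {R : realType} {n l p q : nat}.
Variables (A : 'I_q -> 'M[R]_n) (B : 'I_p -> 'M[R]_(n, l)) (a : nat -> 'I_p).
Variables (M : 'M[R]_n) (W : 'M[R]_l) (Q : 'M[R]_n) (N : nat).
Context {d : measure_display} {Omega : measurableType d} (P : probability Omega R).
Variables (pi : 'I_q -> R) (sigma : nat -> Omega -> 'I_q).
Hypothesis sigma_iid : iid_modes P pi sigma.

Lemma measurable_mode k i : measurable (sigma k @^-1` [set i]).
Proof.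
case: sigma_iid => mS _ _; apply: (mS k).
by exists [set i] => //; rewrite setTI.
Qed.

Lemma mode_prob_ge0 e : 0 <= pi e.
Proof. by case: sigma_iid => _ _ piE; rewrite -lee_fin -(piE 0%N). Qed.

Lemma mode_prob_sum : \sum_e pi e = 1.
Proof.
case: sigma_iid => _ _ piE; apply: EFin_inj; rewrite -sumEFin -(probability_setT P).
under eq_bigr do rewrite -(piE 0%N).
rewrite -measure_bigsetU_ord; first last.
- by move=> i j _ _ [w [/= <- <-]].
- by move=> e; exact: measurable_mode.
congr (P _); apply/seteqP; split => // w _.
by rewrite (bigD1 (sigma 0%N w))//=; left.
Qed.

(** The first modes are the entries of [t]. The intersection over [iota] has the shape required by
    [mutually_independent]; [e0] is the default of [nth]. *)
Definition mode_event e0 (t : seq 'I_q) : set Omega :=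
  \big[setI/setT]_(k <- iota 0 (size t)) (sigma k @^-1` [set nth e0 t k]).

Lemma mode_eventP e0 t w :
  mode_event e0 t w <-> forall k, (k < size t)%N -> sigma k w = nth e0 t k.
Proof.
rewrite /mode_event -bigcap_seq; split => h k.
  by move=> kt; apply: (h k) => /=; rewrite mem_iota.
by rewrite /= mem_iota => kt; exact: h.
Qed.

Lemma mode_event_gen e0 t :
  <<s \bigcup_k mode_algebra (sigma k) >> (mode_event e0 t).
Proof.
rewrite /mode_event; elim/big_ind: _ => [|E1 E2|k _].
- exact: (@measurableT _ (g_sigma_algebraType (\bigcup_k mode_algebra (sigma k)))).
- exact: (@measurableI _ (g_sigma_algebraType (\bigcup_k mode_algebra (sigma k)))).
- apply: sub_sigma_algebra; exists k => //; exists [set nth e0 t k] => //.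
  by rewrite setTI.
Qed.

Lemma measurable_mode_event e0 t : measurable (mode_event e0 t).
Proof.
rewrite /mode_event; elim/big_ind: _ => [|E1 E2|k _]; first exact: measurableT.
  exact: measurableI.
exact: measurable_mode.
Qed.

Lemma mode_event_prob e0 t : P (mode_event e0 t) = (\prod_(e <- t) pi e)%:E.
Proof.
case: sigma_iid => _ ind piE; rewrite /mode_event ind ?iota_uniq//; last first.
  by move=> k _; exists [set nth e0 t k] => //; rewrite setTI.
rewrite (big_nth e0) -prodEFin /index_iota subn0; apply: eq_bigr => k _.
exact: piE.
Qed.

Lemma measurable_initial_state (x0 : Omega -> 'cV[R]_n) :
  initial_state P sigma x0 -> measurable_fun setT (x0 : Omega -> mxB R n 1).
Proof. by move=> [mx0 _] _ U mU; apply: mx0; exists U. Qed.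

(** The path cost is a finite sum, over mode sequences, of the indicator of the sequence times a
    function of [x0]. The modes are independent of [x0], so conditioning turns the indicators into
    the product weights. *)
Lemma is_cost_cost_to_go (x0 : Omega -> 'cV[R]_n) K :
  initial_state P sigma x0 -> admissible N K ->
  is_cost A B a M W Q N P sigma x0 K
    (fun w => cost_to_go A B pi M W Q a K N (x0 w)).
Proof.
move=> ix0 admK; have [_ ind] := ix0; pose e0 := sigma 0%N point.
pose X : {mfun Omega >-> mxB R n 1} := HB.pack x0
  (isMeasurableFun.Build _ _ _ _ _ (measurable_initial_state ix0)).
have := @is_cond_exp_finite _ _ _ _ _ P X (N.-tuple 'I_q)
  (fun t => mode_event e0 t)
  (fun t x => path_cost A B a M W Q N K x (nth e0 t))
  (fun w => path_cost A B a M W Q N K (x0 w) (sigma ^~ w)).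
rewrite (_ : (fun w => \sum_i _) =
    (fun w => cost_to_go A B pi M W Q a K N (x0 w))); last first.
  apply/funext => w; rewrite -(sum_path_cost A B M W Q mode_prob_sum e0).
  by apply: eq_bigr => t _; rewrite mode_event_prob.
apply.
- by move=> t; exact: measurable_mode_event.
- by move=> t E GE; apply: ind => //; exact: mode_event_gen.
- by move=> t; exact: measurable_path_cost.
(* [t0] is the sequence realized at [w]; every other indicator vanishes there. *)
move=> w; pose t0 := [tuple sigma k w | k < N].
have t0E k : (k < N)%N -> nth e0 t0 k = sigma k w.
  by move=> kN; rewrite -[k]/(val (Ordinal kN)) -tnth_nth tnth_mktuple.
rewrite (bigD1 t0)//= big1 ?addr0.
  have t0w : mode_event e0 t0 w.
    by apply/mode_eventP => k; rewrite size_tuple => kN; rewrite t0E.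
  rewrite indicE (mem_set t0w) mul1r.
  by apply: eq_path_cost => k kN; rewrite t0E.
move=> t tt0; rewrite indicE memNset ?mul0r// => /mode_eventP tw.
move/eqP : tt0; apply; apply: eq_from_tnth => k.
by rewrite tnth_mktuple (tnth_nth e0) -tw// size_tuple.
Qed.

Lemma cost_ae_le (x0 : Omega -> 'cV[R]_n) K J1 J2 : initial_state P sigma x0 ->
  is_cost A B a M W Q N P sigma x0 K J1 ->
  is_cost A B a M W Q N P sigma x0 K J2 ->
  {ae P, forall w, J1 w <= J2 w}.
Proof.
move=> ix0.
pose X : {mfun Omega >-> mxB R n 1} := HB.pack x0
  (isMeasurableFun.Build _ _ _ _ _ (measurable_initial_state ix0)).
exact: (@is_cond_exp_le _ _ _ _ _ P X).
Qed.

End costs.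

(** * Optimality of the linear feedback *)

Lemma admissible_linear (R : realType) (n l N : nat) (K : nat -> 'M[R]_(l, n)) :
  admissible N (linear_feedback K).
Proof.
move=> k _ _ [U mU <-].
have := @measurable_cst _ _ (mxB R n 1) (mxB R l n) setT (K k).
exact.
Qed.

Theorem theorem1 (R : realType) (n m r p q : nat)
  (A : 'I_q -> 'M[R]_n) (B : 'I_p -> 'M[R]_(n, m * r))
  (M : 'M[R]_n) (W : 'M[R]_(m * r)) (Q : 'M[R]_n) (Qsym : Q^T = Q)
  (N : nat) (a : nat -> 'I_p)
  (d : measure_display) (Omega : measurableType d) (P : probability Omega R)
  (pi : 'I_q -> R) (sigma : nat -> Omega -> 'I_q)
  (sigma_iid : iid_modes P pi sigma) :
  exists Kstar : nat -> 'M[R]_(m * r, n),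
    forall x0 : Omega -> 'cV[R]_n,
      initial_state P sigma x0 ->
      cost_bounded_below A B a M W Q N P sigma x0 ->
      optimal A B a M W Q N P sigma x0 (linear_feedback Kstar).
Proof.
have [G [S [Kstar [I [F [[_ _ _ Geq Gle] unb]]]]]] :=
  exists_riccati_solution A B M W Q (mode_prob_ge0 sigma_iid)
    (mode_prob_sum sigma_iid) a N.
exists Kstar => x0 ix0 [Y Ylb]; split; first exact: admissible_linear.
pose V K w := cost_to_go A B pi M W Q a K N (x0 w).
have costV K : admissible N K -> is_cost A B a M W Q N P sigma x0 K (V K).
  exact: is_cost_cost_to_go.
exists (V (linear_feedback Kstar)); split.
  exact: (costV _ (@admissible_linear _ _ _ _ _)).
move=> K' J' admK' costJ'.
(* Each gain sequence [F i] has its own exceptional null set; enumerating [I] through [unpickle]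
   merges them into one. *)
have YV : {ae P, forall w, forall j : nat,
    if unpickle j is Some i then Y w <= V (linear_feedback (F i)) w else true}.
  apply: ae_foralln => j; case: unpickle => [i|]; last exact: aeW.
  have admF := @admissible_linear R n (m * r) N (F i).
  exact: (Ylb _ _ admF (costV _ admF)).
(* [J'] may be another version of the cost of [K'], so it is compared almost surely with [V K']. *)
apply: filterS2 YV (cost_ae_le ix0 (costV _ admK') costJ') => w YVw; apply: le_trans.
(* Outside [G], the one-point family of weight 1 at [x0 w] would give some [F i] a cost below
   [Y w]. *)
have Gw : G (x0 w).
  apply: contrapT => nG.
  have [||i] := unb unit (fun=> 1) (fun=> x0 w) _ _ (Y w); [by []|by exists tt|].
  rewrite (big_pred1 tt) => [|[]//]; rewrite mul1r ltNge.
  by have := YVw (pickle i); rewrite pickleK => ->.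
by rewrite /V Geq//; exact: Gle.
Qed.
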